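(* Let $\epsilon\ge 0$. Consider an instance of the restricted assignment problem in which every job $j$ has size $p_j\in\{\epsilon,1\}$ and $OPT_{LP}=1$. Then there is a schedule of makespan at most $5/3+\epsilon$. Equivalently, $OPT\le(5/3+\epsilon)\,OPT_{LP}$, so the integrality gap of the configuration LP on such instances is at most $5/3+\epsilon$.
   Context: Restricted assignment problem: we are given a finite set $\mathcal{J}$ of jobs and a finite set $\mathcal{M}$ of machines. Each job $j$ has a size $p_j\ge 0$ and a nonempty set $\Gamma(j)\subseteq\mathcal{M}$ of machines it may be assigned to. A schedule is a map $\sigma:\mathcal{J}\to\mathcal{M}$ with $\sigma(j)\in\Gamma(j)$. Its makespan is $\max_i\sum_{j\in\sigma^{-1}(i)}p_j$, and $OPT$ is the minimum makespan over all schedules. For $T\ge 0$ and $i\in\mathcal{M}$, let $\mathcal{C}(i,T)$ be the set of configurations for $i$. These are the sets $C\subseteq\{j: i\in\Gamma(j)\}$ with $\sum_{j\in C}p_j\le T$. The configuration LP with target $T$ has a variable $x_{i,C}\ge 0$ for each $i\in\mathcal{M}$ and each $C\in\mathcal{C}(i,T)$, subject to the constraints $\sum_{C\in\mathcal{C}(i,T)}x_{i,C}\le 1$ for each $i\in\mathcal{M}$, and $\sum_{i\in\mathcal{M}}\sum_{C\in\mathcal{C}(i,T),\,C\ni j}x_{i,C}\ge 1$ for each $j\in\mathcal{J}$. $OPT_{LP}$ is the minimum $T$ for which this LP is feasible; one always has $OPT_{LP}\le OPT$. *)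

(* Defs.v *)
From mathcomp Require Import all_boot all_order all_algebra.
Set Implicit Arguments. Unset Strict Implicit. Unset Printing Implicit Defensive.
Import Order.TTheory GRing.Theory Num.Theory.
Local Open Scope ring_scope.

Section RA.
Variables (R : realFieldType) (J M : finType).
Variables (p : J -> R) (Gamma : J -> {set M}).

Definition is_config (T : R) (i : M) (C : {set J}) : bool :=
  (C \subset [set j | i \in Gamma j]) && (\sum_(j in C) p j <= T).

(* The configuration LP with target T is feasible.  x i C is the variable
   x_{i,C}; only its values on configurations are used. *)
Definition config_LP_feasible (T : R) : Prop :=
  exists x : M -> {set J} -> R,
    [/\ (forall i C, is_config T i C -> 0 <= x i C),
        (forall i, \sum_(C | is_config T i C) x i C <= 1) &
        (forall j, 1 <= \sum_(i : M) \sum_(C | is_config T i C && (j \in C)) x i C)].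

Definition is_OPT_LP (T : R) : Prop :=
  config_LP_feasible T /\ (forall T', T' < T -> ~ config_LP_feasible T').

Definition is_schedule (sigma : J -> M) : Prop := forall j, sigma j \in Gamma j.

Definition load (sigma : J -> M) (i : M) : R := \sum_(j | sigma j == i) p j.

Definition makespan_le (sigma : J -> M) (B : R) : Prop := forall i, load sigma i <= B.

End RA.

(* Main.v *)
(* For eps > 0 a configuration is one big job or at most k small ones.  Match the big jobs
   to distinct machines and insert the small jobs one at a time, with capacity
   a = floor(2k/3) + 1 on a machine with a big job and a + k on the others.

   If the new small job cannot be placed, the machines X it reaches by moving small jobs are
   all full.  Give value 3 to each small job in X, value 2k to each big job reachable from
   the big jobs in X by alternating paths, and price 3k to each machine in X: by LP duality
   some machine i outside X without a big job can receive a reachable big job, and at most a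
   of the small jobs on i have nowhere to go outside X.  If i carries at most a small jobs, a
   big job can leave X along an alternating path.  Otherwise either a small job on i moves
   away, or X together with the machines reached from i is again a full set with a surplus,
   and by induction a big job can be moved out of this larger set, which makes room for a
   small job of i.  Only the local structure [agree X] has to survive these changes. *)
Require Import Defs.
From mathcomp Require Import all_boot all_order all_algebra.
From mathcomp Require Import zify lra.
Import Order.TTheory GRing.Theory Num.Theory.

Set Implicit Arguments.
Unset Strict Implicit.
Unset Printing Implicit Defensive.

Section PartialSchedules.
Variables (J M : finType) (Gamma : J -> {set M}) (big : pred J).

Definition valid (f : J -> option M) := forall j m, f j = Some m -> m \in Gamma j.

Definition located (f : J -> option M) (X : {set M}) (j : J) :=
  if f j is Some m then m \in X else false.

(* [j] could take over the place of the job [j'] of the same kind. *)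
Definition step (f : J -> option M) (j j' : J) :=
  (big j == big j') && located f (Gamma j) j'.

Definition jobs_at (b : bool) (f : J -> option M) (m : M) : {set J} :=
  [set j | (big j == b) && (f j == Some m)].

Definition cnt b f m := #|jobs_at b f m|.

Definition reach f (A : {set J}) : {set J} :=
  [set j | [exists j0 in A, connect (step f) j0 j]].

Definition targets (A : {set J}) : {set M} := \bigcup_(j in A) Gamma j.

Lemma locatedP f (X : {set M}) j : reflect (exists2 m, f j = Some m & m \in X) (located f X j).
Proof.
rewrite /located; case E: (f j) => [m|]; last by constructor; case.
by apply: (iffP idP) => [mX|[m' [->]]] //; exists m.
Qed.

Lemma targetsP (A : {set J}) m : reflect (exists2 j, j \in A & m \in Gamma j) (m \in targets A).
Proof. exact: bigcupP. Qed.

Lemma reach_min f (A H : {set J}) :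
  A \subset H -> (forall j j', j \in H -> step f j j' -> j' \in H) ->
  reach f A \subset H.
Proof.
move=> AH cH; apply/subsetP=> j; rewrite inE => /exists_inP[j0 /(subsetP AH)].
move=> j0H /connectP[p]; elim: p j0 j0H => [|j1 p IH] j0 j0H /= => [_ -> //|].
by case/andP=> /(cH _ _ j0H) /IH.
Qed.

Lemma sub_reach f (A : {set J}) : A \subset reach f A.
Proof. by apply/subsetP=> j jA; rewrite inE; apply/exists_inP; exists j. Qed.

Lemma reach_step f (A : {set J}) j j' : j \in reach f A -> step f j j' -> j' \in reach f A.
Proof.
rewrite !inE => /exists_inP[j0 j0A c] s; apply/exists_inP; exists j0 => //.
exact: connect_trans c (connect1 s).
Qed.

Lemma reach_kind f b (A : {set J}) :
  {in A, forall j, big j = b} -> {in reach f A, forall j, big j = b}.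
Proof.
move=> Ab j jR; suff /subsetP/(_ j jR) : reach f A \subset [set j | big j == b].
  by rewrite inE => /eqP.
apply: reach_min => [|j1 j2]; first by apply/subsetP=> i /Ab; rewrite inE => ->.
by rewrite !inE => /eqP<- /andP[/eqP->].
Qed.

Lemma sub_reach_ext f g (A B : {set J}) :
  A \subset B -> {in reach f A, f =1 g} -> reach f A \subset reach g B.
Proof.
move=> AB fg; suff: reach f A \subset reach f A :&: reach g B by rewrite subsetI => /andP[].
apply: reach_min => [|j j'].
  by rewrite subsetI sub_reach (subset_trans AB (sub_reach _ _)).
rewrite !in_setI => /andP[jf jg] s; have j'f := reach_step jf s.
by rewrite j'f; apply: reach_step jg _; rewrite /step /located -fg.
Qed.

Lemma mem_targets_step f (A : {set J}) j m :
  m \in targets (reach f A) -> f j = Some m -> {in A, forall j', big j' = big j} ->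
  j \in reach f A.
Proof.
move=> /targetsP[j' j'A mj'] fj Ab; apply: (reach_step j'A).
by rewrite /step (reach_kind Ab j'A) eqxx /located fj.
Qed.

Lemma cnt_upd b f j0 x m :
  cnt b (fun j => if j == j0 then Some x else f j) m + (b == big j0) * (f j0 == Some m)
    = cnt b f m + (b == big j0) * (x == m).
Proof.
rewrite /cnt /jobs_at (cardsD1 j0) [in RHS](cardsD1 j0) !inE eqxx /=.
set A := _ :\ _; set B := _ :\ _; have -> : A = B.
  by apply/setP=> j; rewrite !inE; case: (j == j0).
rewrite (inj_eq Some_inj) [big j0 == b]eq_sym.
case: (b == big j0); rewrite ?mul0n ?mul1n ?addn0 /=; lia.
Qed.

Lemma shift_path f j p x :
  valid f -> path (step f) j p -> uniq (j :: p) -> x \in Gamma (last j p) ->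
  exists g, [/\ valid g,
    (forall j', j' \notin j :: p -> g j' = f j'),
    (forall j', j' \in j :: p -> g j' = Some x \/
       exists2 j'', j'' \in p & exists2 m, f j'' = Some m & g j' = Some m) &
    forall b m, cnt b g m + (b == big j) * (f j == Some m)
              = cnt b f m + (b == big j) * (x == m)].
Proof.
move=> vf; elim: p j => [|j1 p IH] j /=.
  move=> _ _ xj; exists (fun j' => if j' == j then Some x else f j'); split.
  - by move=> j' m; case: eqP => [-> [<-]|_ /vf].
  - by move=> j'; rewrite inE => /negPf->.
  - by move=> j'; rewrite inE => ->; left.
  - by move=> b m; apply: cnt_upd.
case/andP=> /andP[/eqP kind /locatedP[y fj1 yj]] pth /andP[jn un] xl.
have [g [vg goff gon gcnt]] := IH j1 pth un xl.
exists (fun j' => if j' == j then Some y else g j'); split.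
- by move=> j' m; case: eqP => [-> [<-]|_ /vg].
- by move=> j'; rewrite inE negb_or => /andP[/negPf-> /goff].
- move=> j'; rewrite inE; case: eqP => [_ _|_ /= /gon[|[j2 j2p [m fj2 gj']]]].
  + by right; exists j1; [exact: mem_head|exists y].
  + by left.
  + by right; exists j2; [rewrite inE j2p orbT|exists m].
- move=> b m; have := cnt_upd b g j y m; have := gcnt b m.
  rewrite (goff j jn) kind fj1 (inj_eq Some_inj) => e ->.
  exact: e.
Qed.

(* Along a shortest path towards the free place [x], every job of the path [D] takes the
   place of its successor. *)
Lemma shift f (A : {set J}) b x :
  valid f -> {in A, forall j, big j = b} -> x \in targets (reach f A) ->
  exists g j0 (D : {set J}),
  [/\ [/\ j0 \in A, j0 \in D, D \subset reach f A & valid g],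
      (forall j, j \notin D -> g j = f j),
      (forall j, j \in D -> j != j0 -> f j != None),
      (forall j, j \in D -> g j = Some x \/
         exists2 j', j' \in D & exists2 m, f j' = Some m & g j = Some m) &
      (forall (H : {set J}) j, (forall j1 j2, j1 \in H -> step f j1 j2 -> j2 \in H) ->
         j \in D -> j \in H -> x \in targets H)
   /\ (forall b' m, cnt b' g m + (b' == b) * (f j0 == Some m)
                  = cnt b' f m + (b' == b) * (x == m))].
Proof.
move=> vf Ab /targetsP[j]; rewrite inE => /exists_inP[j0 j0A /connectP[p0 p0j0 ->]].
case/shortenP: p0j0 => p pth un _ xl.
have [g [vg goff gon gcnt]] := shift_path vf pth un xl.
exists g, j0, [set j in j0 :: p]; split.
- rewrite inE mem_head j0A; split=> //; apply/subsetP=> j'; rewrite !inE.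
  case/predU1P=> [->|j'p]; apply/exists_inP; exists j0 => //.
  have j'p2 : j' \in j0 :: p by rewrite inE j'p orbT.
  by case/splitPl: j'p2 pth => p1 p2 <-; rewrite cat_path => /andP[q _]; apply/connectP; exists p1.
- by move=> j'; rewrite inE => /goff.
- move=> j'; rewrite !inE => /predU1P[->|]; first by rewrite eqxx.
  move=> j'p _; case/splitPr: j'p pth => p1 p2; rewrite cat_path /= => /and3P[_ + _].
  by case/andP=> _ /locatedP[m ->].
- move=> j'; rewrite inE => /gon[->|[j'' j''p ?]]; [by left|right].
  by exists j'' => //; rewrite !inE j''p orbT.
- split=> [H j' cH|b' m]; last by have := gcnt b' m; rewrite (Ab _ j0A).
  rewrite inE => /[dup] j'p; case/splitPl: j'p pth xl {un gon goff} => p1 p2 <-.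
  rewrite cat_path last_cat => /andP[_ p2p] xl _ lH; apply/targetsP.
  exists (last (last j0 p1) p2) => //; move: lH.
  elim: p2 (last j0 p1) p2p {xl} => //= j2 p2 IH j1 /andP[s /IH] + j1H; apply.
  exact: cH s.
Qed.

(* The big jobs reachable by alternating paths from those placed in [X]. *)
Definition breach f (X : {set M}) := reach f [set j | big j && located f X j].

Lemma big_breach f X j : j \in breach f X -> big j.
Proof. by apply: reach_kind => j'; rewrite inE => /andP[]. Qed.

Lemma mem_breach f X j :
  big j -> located f (X :|: targets (breach f X)) j -> j \in breach f X.
Proof.
move=> bj /locatedP[m fj]; rewrite inE => /orP[mX|mT].
  by apply: (subsetP (sub_reach _ _)); rewrite inE bj /located fj.
by apply: mem_targets_step mT fj _ => j'; rewrite inE bj => /andP[].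
Qed.

Lemma breach_ext f g X :
  {in breach f X, f =1 g} ->
  (forall j, big j -> located g (X :|: targets (breach f X)) j -> j \in breach f X) ->
  breach f X = breach g X.
Proof.
move=> fg gX; have XU := subsetUl X (targets (breach f X)).
have locX h j : located h X j -> located h (X :|: targets (breach f X)) j.
  by case/locatedP=> m hj /(subsetP XU) mU; apply/locatedP; exists m.
apply/eqP; rewrite eqEsubset; apply/andP; split.
  apply: (sub_reach_ext _ fg); apply/subsetP=> j; rewrite !inE => /andP[bj lj].
  by rewrite bj /located -fg // mem_breach ?locX.
apply: reach_min => [|j j' jG /andP[/eqP kind /locatedP[m gj' mj]]].
  by apply/subsetP=> j; rewrite inE => /andP[bj lj]; rewrite gX ?locX.
apply: gX; first by rewrite -kind (big_breach jG).
by apply/locatedP; exists m; rewrite // inE; apply/orP; right; apply/targetsP; exists j.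
Qed.

Definition agree X f g :=
  [/\ forall j, (f j == None) = (g j == None),
      forall j, ~~ big j -> located f X j || located g X j -> f j = g j,
      breach f X = breach g X & {in breach f X, f =1 g}].

Lemma agree_sym X f g : agree X f g -> agree X g f.
Proof.
case=> e1 e2 e3 e4; split=> // [j nb|j]; last by rewrite -e3 => /e4.
by rewrite orbC => /(e2 _ nb).
Qed.

Lemma agree_trans X f g h : agree X f g -> agree X g h -> agree X f h.
Proof.
case=> e1 e2 e3 e4 [d1 d2 d3 d4]; split=> [j|j nb|| j jf]; rewrite ?e1 ?e3 //.
  case/orP=> l.
    have fgj : f j = g j by apply: e2; rewrite ?l.
    by rewrite fgj d2 // /located -fgj; move: l; rewrite /located => ->.
  have ghj : g j = h j by apply: d2; rewrite ?l ?orbT.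
  by rewrite -ghj e2 // /located ghj; move: l; rewrite /located => ->; rewrite orbT.
by rewrite e4 // d4 // -e3.
Qed.

Lemma agree_sub (X X' : {set M}) f g : X \subset X' -> agree X' f g -> agree X f g.
Proof.
move=> XX' [e1 e2 e3 e4].
have lS h (Y Y' : {set M}) j : Y \subset Y' -> located h Y j -> located h Y' j.
  by move=> YY' /locatedP[m hj /(subsetP YY') mY']; apply/locatedP; exists m.
have sG : breach f X \subset breach f X'.
  apply: sub_reach_ext => //; apply/subsetP=> j; rewrite !inE => /andP[->].
  exact: lS.
have e5 : {in breach f X, f =1 g} by move=> j /(subsetP sG) /e4.
split=> // [j nb l|]; first by apply: e2 => //; case/orP: l => /(lS _ _ _ _ XX')->; rewrite ?orbT.
apply: breach_ext => // j bj l.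
have sT : targets (breach f X) \subset targets (breach g X').
  rewrite -e3; apply/subsetP=> m /targetsP[j' /(subsetP sG) j'G mj']; apply/targetsP.
  by exists j'.
have jG : j \in breach g X' by apply: mem_breach => //; apply: lS l; apply: setUSS.
by apply: mem_breach => //; rewrite /located e4 // e3.
Qed.

Lemma agree_at X f g b m : agree X f g -> m \in X -> jobs_at b f m \subset jobs_at b g m.
Proof.
move=> [_ e2 _ e4] mX; apply/subsetP=> j; rewrite !inE => /andP[/eqP bj /eqP fj].
have l : located f X j by apply/locatedP; exists m.
rewrite bj eqxx /=; case bE: (big j) {bj}.
  rewrite -e4 ?fj // mem_breach //; apply/locatedP; exists m => //.
  by rewrite inE mX.
by rewrite -e2 ?fj ?bE ?l.
Qed.

Lemma agree_cnt X f g b m : agree X f g -> m \in X -> cnt b f m = cnt b g m.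
Proof.
move=> fg mX; rewrite /cnt; congr #|pred_of_set _|; apply/eqP.
by rewrite eqEsubset (agree_at _ fg) // (agree_at _ (agree_sym fg)).
Qed.

Lemma cntP b f m : reflect (exists2 j, big j = b & f j = Some m) (cnt b f m != 0).
Proof.
rewrite -lt0n; apply: (iffP card_gt0P) => [[j]|[j bj fj]].
  by rewrite inE => /andP[/eqP bj /eqP fj]; exists j.
by exists j; rewrite inE bj fj !eqxx.
Qed.

Definition closed f (X : {set M}) :=
  forall j, ~~ big j -> located f X j -> Gamma j \subset X.

Lemma agree_closed X f g : agree X f g -> closed f X -> closed g X.
Proof.
move=> [_ e2 _ _] cX j nb l; apply: cX => //.
by move: (l); rewrite /located e2 // l orbT.
Qed.

(* Small jobs on [i] that can leave [i] only for a machine in [X]. *)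
Definition stuck f X i := [set j in jobs_at false f i | Gamma j \subset i |: X].

Lemma agree_stuck X f g i : agree X f g -> valid f -> i \notin X ->
  stuck g X i \subset stuck f X i.
Proof.
move=> [e1 e2 _ _] vf iX; apply/subsetP=> j; rewrite !inE.
move=> /andP[/andP[/eqP bj /eqP gj] jX]; rewrite bj jX eqxx andbT /=.
case fj: (f j) (e1 j) => [m|]; rewrite gj // => _.
have := subsetP jX _ (vf _ _ fj); rewrite !inE => /orP[/eqP->|mX] //.
by rewrite -fj e2 ?gj ?bj // /located fj mX.
Qed.

Variables (k a : nat).

(* A machine takes at most [a] small jobs next to a big job and [a + k] without one. *)
Definition admissible f :=
  [/\ valid f, forall j, big j -> f j != None, forall m, cnt true f m <= 1
    & forall m, cnt false f m + k * cnt true f m <= a + k].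

Definition surplus f (X : {set M}) :=
  3 * k * #|X| < \sum_(m in X) (3 * cnt false f m + 2 * k * cnt true f m).

Lemma agree_surplus X f g : agree X f g -> surplus f X -> surplus g X.
Proof.
by rewrite /surplus => fg; rewrite (eq_bigr (fun m => 3 * cnt false g m + 2 * k * cnt true g m))
  // => m mX; rewrite !(agree_cnt _ fg).
Qed.

Lemma augment f X i m :
  admissible f -> closed f X -> i \notin X -> m \notin X -> m != i ->
  m \in targets (reach f (jobs_at false f i)) ->
  cnt false f m + k * cnt true f m < a + k ->
  exists g, [/\ admissible g, agree X f g, cnt true g i = cnt true f i
              & cnt false g i < cnt false f i].
Proof.
move=> [vf bf bf1 capf] cX iX mX mi mT um.
have small_i : {in jobs_at false f i, forall j, big j = false}.
  by move=> j; rewrite inE => /andP[/eqP].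
have [g [j0 [D [[j0i _ DR vg] goff gas gon [gH gcnt]]]]] := shift vf small_i mT.
have Dsmall j : j \in D -> ~~ big j.
  by move=> /(subsetP DR) /(reach_kind small_i) ->.
have gbig j : big j -> g j = f j.
  by move=> bj; apply: goff; apply: contraL bj => /Dsmall.
have fj0 : f j0 = Some i by move: j0i; rewrite inE => /andP[_ /eqP].
have gt y : cnt true g y = cnt true f y by have := gcnt true y; rewrite !mul0n !addn0.
have gf y : cnt false g y + (i == y) = cnt false f y + (m == y).
  by have := gcnt false y; rewrite fj0 (inj_eq Some_inj) !mul1n.
have DX j : j \in D -> ~~ located f X j.
  move=> jD; apply: contra mX => jX.
  have /targetsP[j1] : m \in targets [set j | ~~ big j && located f X j].
    apply: (gH _ j) => //; last by rewrite inE Dsmall.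
    move=> j1 j2; rewrite !inE => /andP[b1 l1] /andP[/eqP <- /locatedP[y fj2 yj1]].
    rewrite b1; apply/locatedP; exists y => //.
    exact: (subsetP (cX _ b1 l1)).
  by rewrite inE => /andP[b1 l1]; apply/subsetP/cX.
have gX j : j \in D -> ~~ located g X j.
  move=> jD; rewrite /located; case: (gon j jD) => [->|[j' /DX j'X [y fj' ->]]] //.
  by move: j'X; rewrite /located fj'.
have gn j : (f j == None) = (g j == None).
  case: (boolP (j \in D)) => [jD|/goff->] //.
  have -> : (g j == None) = false by case: (gon j jD) => [->|[j' _ [y _ ->]]].
  by have [->|/(gas j jD)/negPf] := eqVneq j j0; rewrite ?fj0.
have fg : {in breach f X, f =1 g} by move=> j /big_breach /gbig.
exists g; split=> //; last by have := gf i; rewrite eqxx (negPf mi); lia.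
  split=> // [j bj|y|y]; rewrite ?gbig ?gt ?bf //.
  by have := gf y; have := capf y; case: (m =P y) um => [<-|_] um; lia.
split=> // [j nb|].
  by case: (boolP (j \in D)) => [jD|/goff->] //; rewrite (negPf (DX j jD)) (negPf (gX j jD)).
apply: breach_ext => // j bj; rewrite /located gbig //; exact: mem_breach.
Qed.

Lemma exchange f (X : {set M}) i :
  admissible f -> i \notin X -> cnt true f i = 0 -> i \in targets (breach f X) ->
  cnt false f i <= a ->
  exists g x, [/\ admissible g, forall j, ~~ big j -> g j = f j,
    forall y, y != i -> cnt true g y <= cnt true f y,
    [/\ x \in X, cnt true f x = 1 & cnt true g x = 0] &
    forall Y : {set M}, i \notin Y -> i \notin targets (breach f Y) ->
      x \notin Y /\ agree Y f g].
Proof.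
move=> [vf bf bf1 capf] iX i0 iT ia.
have big_X : {in [set j | big j && located f X j], forall j, big j = true}.
  by move=> j; rewrite inE => /andP[].
have [g [j0 [D [[j0X j0D DR vg] goff gas gon [gH gcnt]]]]] := shift vf big_X iT.
have Dbig j : j \in D -> big j by move=> /(subsetP DR) /(reach_kind big_X) ->.
have gsmall j : ~~ big j -> g j = f j.
  by move=> nb; apply: goff; apply: contra nb => /Dbig.
move: j0X; rewrite inE => /andP[bj0 /locatedP[x fj0 xX]].
have gf y : cnt false g y = cnt false f y by have := gcnt false y; rewrite !mul0n !addn0.
have gt y : cnt true g y + (x == y) = cnt true f y + (i == y).
  by have := gcnt true y; rewrite fj0 (inj_eq Some_inj) !mul1n.
have fx : cnt true f x = 1.
  by apply/eqP; rewrite eqn_leq bf1 lt0n; apply/cntP; exists j0.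
have ix : i != x by apply: contraNneq iX => ->.
exists g, x; split=> //.
- split=> // [j bj|y|y].
  + case: (boolP (j \in D)) => [jD|/goff->]; last exact: bf.
    by case: (gon j jD) => [->|[j' _ [y _ ->]]].
  + by have := gt y; have := bf1 y; case: (i =P y) => [<-|_]; lia.
  + have := gt y; have := capf y; rewrite gf.
    case: (i =P y) => [<-|_]; first by rewrite i0 eq_sym (negPf ix) => _; nia.
    by move=> c e; apply: leq_trans c; rewrite leq_add2l leq_mul2l; apply/orP; right; lia.
- by move=> y /negPf; rewrite eq_sym => yi; have := gt y; rewrite yi; lia.
- by split=> //; have := gt x; rewrite fx eqxx (negPf ix); lia.
move=> Y iY iTY.
have DY j : j \in D -> j \notin breach f Y.
  by move=> jD; apply: contra iTY; apply: (gH _ j) => // j1 j2; apply: reach_step.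
have fY j : j \in D -> ~~ located f (Y :|: targets (breach f Y)) j.
  by move=> jD; apply: contra (DY j jD) => /mem_breach; apply; apply: Dbig.
split.
  by apply: contra (fY _ j0D) => xY; apply/locatedP; exists x; rewrite // inE xY.
have fg : {in breach f Y, f =1 g} by move=> j jG; rewrite goff //; apply: contraL jG => /DY.
split=> // [j|j nb|].
- case: (boolP (j \in D)) => [jD|/goff->] //.
  rewrite (negPf (bf _ (Dbig _ jD))).
  by case: (gon j jD) => [->|[j' _ [y _ ->]]].
- by rewrite gsmall.
apply: breach_ext => // j bj; case: (boolP (j \in D)) => [jD|/goff gj].
  case: (gon j jD) => [gj|[j' /fY j'Y [y fj' gj]]]; rewrite /located gj.
    by rewrite inE (negPf iY) (negPf iTY).
  by move: j'Y; rewrite /located fj' => /negPf->.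
by rewrite /located gj; apply: mem_breach.
Qed.

Lemma sum_located (f : J -> option M) (z : J -> nat) : \sum_i \sum_(j | f j == Some i) z j <= \sum_j z j.
Proof.
rewrite (exchange_big_dep xpredT) //=; apply: leq_sum => j _.
case: (f j) => [m|]; last by rewrite big_pred0.
by rewrite (big_pred1 m) // => i; rewrite (inj_eq Some_inj) eq_sym.
Qed.

(* Weak duality, for configurations made of one big job or of at most [k] small ones. *)
Hypothesis dual : forall (z : J -> nat) (y : M -> nat),
  (forall i j, big j -> i \in Gamma j -> z j <= y i) ->
  (forall i (C : {set J}), (forall j, j \in C -> ~~ big j && (i \in Gamma j)) ->
     #|C| <= k -> \sum_(j in C) z j <= y i) ->
  \sum_j z j <= \sum_i y i.
Hypothesis a_lb : 2 * k < 3 * a.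

(* Otherwise the following values would form an unbounded direction of the dual of the
   configuration LP: a big job in [breach f X] gets 2k, a small job that lies in [X] or is
   stuck gets 3. *)
Lemma candidate f (X : {set M}) :
  admissible f -> closed f X -> surplus f X ->
  exists i, [/\ i \notin X, cnt true f i = 0, i \in targets (breach f X)
              & #|stuck f X i| <= a].
Proof.
move=> [vf bf bf1 capf] cX sX; pose T := targets (breach f X).
pose Z i := [&& i \notin X, cnt true f i == 0 & i \in T].
have [/existsP[i /andP[/and3P[iX /eqP i0 iT] ia]]|noZ] :=
  boolP [exists i, Z i && (#|stuck f X i| <= a)]; first by exists i.
have {noZ} big_stuck i : Z i -> a < #|stuck f X i|.
  by move=> Zi; move/existsPn/(_ i): noZ; rewrite Zi ltnNge.
pose S := [set j | ~~ big j && (located f X j || [exists i, Z i && (j \in stuck f X i)])].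
pose z j := if big j then 2 * k * (j \in breach f X) else 3 * (j \in S).
pose y i := if i \in X then 3 * k else if i \in T then
  (if cnt true f i == 0 then minn (3 * k) (3 * #|stuck f X i|) else 2 * k) else 0.
have small_z (C : {set J}) : (forall j, j \in C -> ~~ big j) ->
    \sum_(j in C) z j = 3 * #|C :&: S|.
  move=> Cs; rewrite (eq_bigr (fun j => 3 * (j \in S))); last first.
    by move=> j /Cs /negPf bj; rewrite /z bj.
  rewrite -big_distrr /= -sum1_card; congr (_ * _).
  transitivity (\sum_(j | (j \in C) && (j \in S)) 1).
    by rewrite big_mkcondr; apply: eq_bigr => j _; case: (j \in S).
  by apply: eq_bigl => j; rewrite in_setI.
have : \sum_j z j <= \sum_i y i.
  apply: dual => [i j bj ij|i C Ci Ck].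
    rewrite /z bj /y; case: (boolP (j \in breach f X)) => jG; last by rewrite muln0.
    have -> : i \in T by apply/targetsP; exists j.
    case: ifP => iX; first by rewrite muln1 leq_mul2r orbT.
    case: ifP => [i0|_]; last by rewrite muln1.
    have := big_stuck i; rewrite /Z iX i0 /= => /(_ _).
    have -> : i \in T by apply/targetsP; exists j.
    by move=> /(_ isT); lia.
  rewrite small_z => [|j /Ci /andP[] //].
  have le_k : 3 * #|C :&: S| <= 3 * k.
    by rewrite leq_mul2l /= (leq_trans _ Ck) // subset_leq_card // subsetIl.
  rewrite /y; case: (boolP (i \in X)) => // iX.
  have CSi j : j \in C :&: S -> Z i && (j \in stuck f X i).
    rewrite in_setI => /andP[/Ci/andP[nb ij]]; rewrite inE nb /= => /orP[l|].
      by rewrite (subsetP (cX _ nb l) _ ij) in iX.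
    case/existsP=> i' /andP[Zi' ji']; suff -> : i = i' by rewrite Zi'.
    move: ji'; rewrite inE => /andP[_ /subsetP/(_ _ ij)].
    by rewrite !inE (negPf iX) orbF => /eqP.
  have [/eqP|/set0Pn[j /CSi /andP[/and3P[_ -> ->] _]]] := boolP (C :&: S == set0).
    by move=> ->; rewrite cards0.
  rewrite leq_min le_k leq_mul2l /= subset_leq_card //.
  by apply/subsetP=> j' /CSi /andP[].
rewrite leqNgt => /negP[]; apply: leq_trans (sum_located f z).
have w_ge b i : \sum_(j in jobs_at b f i) z j <= \sum_(j | f j == Some i) z j.
  rewrite [X in _ <= X](bigID (mem (jobs_at b f i))) /= -[X in X <= _]addn0.
  rewrite leq_add // leq_eqVlt; apply/orP; left; apply/eqP; apply: eq_bigl => j.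
  by rewrite inE; case: (f j == Some i); rewrite ?andbF.
have smallE i : \sum_(j in jobs_at false f i) z j = 3 * #|jobs_at false f i :&: S|.
  by apply: small_z => j; rewrite inE => /andP[/eqP->].
rewrite (bigID (mem X)) [X in _ < X](bigID (mem X)) /= -addSn leq_add //.
  rewrite (eq_bigr (fun=> 3 * k)) => [|i iX]; last by rewrite /y iX.
  rewrite sum_nat_const mulnC; apply: leq_trans sX _; apply: leq_sum => i iX.
  rewrite [X in _ <= X](bigID (mem (jobs_at false f i))) /= leq_add //.
    rewrite (eq_bigl (fun j => j \in jobs_at false f i)) => [|j]; last first.
      by rewrite /= inE; case: (f j == Some i); rewrite ?andbF.
    rewrite smallE leq_mul2l /= subset_leq_card // subsetI subxx /=.
    apply/subsetP=> j; rewrite !inE => /andP[/eqP bj /eqP fj].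
    by rewrite bj /= /located fj iX.
  rewrite (eq_bigl (fun j => j \in jobs_at true f i)) => [|j]; last first.
    by rewrite /= !inE; case: (f j == Some i); case: (big j).
  rewrite (eq_bigr (fun=> 2 * k)) => [|j]; first by rewrite sum_nat_const [leqRHS]mulnC.
  rewrite inE => /andP[/eqP bj /eqP fj]; rewrite /z bj mem_breach ?muln1 //.
  by rewrite /located fj inE iX.
apply: leq_sum => i iX; rewrite /y (negPf iX); case: ifP => // iT.
case: ifP => [i0|/negbT /cntP[j bj fj]].
  apply: leq_trans (w_ge false i); rewrite smallE geq_min; apply/orP; right.
  rewrite leq_mul2l /= subset_leq_card //; apply/subsetP=> j ji; rewrite in_setI.
  have [jf nb] : j \in jobs_at false f i /\ ~~ big j.
    by move: ji; rewrite !inE => /andP[/andP[/eqP bj ->] _]; rewrite bj.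
  rewrite jf inE nb /=; apply/orP; right.
  by apply/existsP; exists i; rewrite /Z iX i0 iT.
apply: leq_trans (w_ge true i); rewrite (big_setD1 j) /=; last by rewrite inE bj fj !eqxx.
rewrite /z bj mem_breach ?muln1 ?leq_addr //.
by apply/locatedP; exists i; rewrite // inE iT orbT.
Qed.

Lemma small_cnt f g m : (forall j, ~~ big j -> f j = g j) -> cnt false f m = cnt false g m.
Proof.
move=> fg; apply: eq_card => j; rewrite !inE; case bj: (big j) => //=.
by rewrite fg ?bj.
Qed.

Lemma reach_located f A (X : {set M}) :
  targets (reach f A) \subset X -> {in reach f A, forall j, j \in A \/ located f X j}.
Proof.
move=> TX j jP; apply/orP.
suff /subsetP/(_ j jP) : reach f A \subset reach f A :&: [set j | (j \in A) || located f X j].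
  by rewrite in_setI inE => /andP[].
apply: reach_min => [|j1 j2].
  by rewrite subsetI sub_reach; apply/subsetP=> j1; rewrite inE => ->.
rewrite !in_setI => /andP[j1P _] s; rewrite (reach_step j1P s) inE; apply/orP; right.
case/andP: s => _ /locatedP[m fj2 mj1]; apply/locatedP; exists m => //.
by apply: (subsetP TX); apply/targetsP; exists j1.
Qed.

Lemma saturated_weight f m :
  admissible f -> a + k <= cnt false f m + k * cnt true f m ->
  3 * a + 2 * k <= 3 * cnt false f m + 2 * k * cnt true f m.
Proof.
move=> [_ _ b1 _]; have := b1 m.
by case: (cnt true f m) => [|[|//]] _; rewrite ?muln0 ?muln1; lia.
Qed.

(* The conclusion leaves room for a big job on [i]; it is not carried out here because
   [exchange] may take the big job from different sets. *)
Lemma expose f (X : {set M}) :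
  0 < k -> admissible f -> closed f X -> surplus f X ->
  exists g i, [/\ admissible g, agree X f g, i \notin X
    & [/\ cnt true g i = 0, i \in targets (breach g X) & cnt false g i <= a]].
Proof.
move=> k0; have [n] := ubnP #|~: X|; elim: n X f => // n IH X f /ltnSE leX af cX sX.
have [i [iX i0 iT ia]] := candidate af cX sX.
have [N] := ubnP (cnt false f i).
elim: N f af cX sX i0 iT ia => // N IHN f af cX sX i0 iT ia /ltnSE fN.
have [na|na] := leqP (cnt false f i) a; first by exists f, i.
have [vf bf bf1 capf] := af.
have k_le : 3 * k <= 3 * a + 2 * k by move: a_lb; clear; lia.
have next g : admissible g -> agree X f g -> cnt true g i = 0 ->
    cnt false g i < cnt false f i ->
    exists h i', [/\ admissible h, agree X f h, i' \notin X
      & [/\ cnt true h i' = 0, i' \in targets (breach h X) & cnt false h i' <= a]].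
  move=> ag fg gi0 gi; have [] := IHN g ag (agree_closed fg cX) (agree_surplus fg sX) gi0.
  - by case: fg => _ _ <-.
  - exact: leq_trans (subset_leq_card (agree_stuck fg vf iX)) ia.
  - exact: leq_trans gi fN.
  by move=> h [i' [? gh ? ?]]; exists h, i'; split=> //; apply: agree_trans fg gh.
pose P := reach f (jobs_at false f i); pose X' := i |: (X :|: targets P).
have small_i : {in jobs_at false f i, forall j, big j = false}.
  by move=> j; rewrite inE => /andP[/eqP].
have [/existsP[m /and4P[mP mX mi um]]|] :=
  boolP [exists m, [&& m \in targets P, m \notin X, m != i
                     & cnt false f m + k * cnt true f m < a + k]].
  have [g [ag fg gi0 gi]] := augment af cX iX mX mi mP um.
  by apply: (next g); rewrite ?gi0.
move/existsPn=> full.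
have {full} sat m : m \in X' -> m \notin X -> m != i ->
    3 * a + 2 * k <= 3 * cnt false f m + 2 * k * cnt true f m.
  rewrite !inE => + mX mi; rewrite (negPf mX) (negPf mi) /= => mP.
  by apply: saturated_weight => //; have := full m; rewrite mP mX mi /= -leqNgt.
have XX' : X \subset X' by apply/subsetP=> m mX; rewrite !inE mX orbT.
have TX' : targets P \subset X' by apply/subsetP=> m mT; rewrite !inE mT !orbT.
have iX' : i \in X' by rewrite !inE eqxx.
have cX' : closed f X'.
  move=> j nb /locatedP[m fj]; have PT : j \in P -> Gamma j \subset X'.
    by move=> jP; apply: subset_trans TX'; apply: bigcup_sup.
  rewrite !inE => /or3P[/eqP mi|mX|mT].
  - apply: PT; apply: (subsetP (sub_reach _ _)).
    by rewrite inE (negPf nb) fj mi !eqxx.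
  - by apply: subset_trans XX'; apply: cX; rewrite // /located fj.
  - apply: PT; apply: mem_targets_step mT fj _ => j' /small_i ->.
    by rewrite (negPf nb).
have sX' : surplus f X'.
  have [j ji jS] : exists2 j, j \in jobs_at false f i & j \notin stuck f X i.
    apply/subsetPn; apply: contraL na => /subset_leq_card ji.
    by rewrite -leqNgt (leq_trans ji).
  move: jS; rewrite inE ji /= => /subsetPn[m0 m0j].
  rewrite !inE negb_or => /andP[m0i m0X].
  have m0X' : m0 \in X'.
    apply: (subsetP TX'); apply/targetsP; exists j => //.
    exact: (subsetP (sub_reach _ _)).
  rewrite /surplus (bigID (mem X)) /= -(cardsID X X') (setIidPr XX') mulnDr -addSn.
  apply: leq_add.
    rewrite [leqRHS](eq_bigl (fun m => m \in X)) // => m.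
    by have := subsetP XX' m; case: (m \in X) => [->|]; rewrite ?andbF.
  rewrite (eq_bigl (fun m => m \in X' :\: X)) => [|m]; last by rewrite in_setD andbC.
  rewrite (big_setD1 i) /=; last by rewrite in_setD iX iX'.
  rewrite (cardsD1 i) in_setD iX iX' /=.
  have m0Y : m0 \in (X' :\: X) :\ i by rewrite in_setD1 m0i in_setD m0X m0X'.
  rewrite (big_setD1 m0) //= (cardsD1 m0) m0Y.
  have := sat m0 m0X' m0X m0i.
  have : 3 * k * #|(X' :\: X) :\ i :\ m0| <=
     \sum_(m in (X' :\: X) :\ i :\ m0) (3 * cnt false f m + 2 * k * cnt true f m).
    rewrite mulnC -sum_nat_const; apply: leq_sum => m.
    rewrite !in_setD1 in_setD => /and4P[_ mi mX mX'].
    exact: leq_trans k_le (sat m mX' mX mi).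
  rewrite i0 muln0 addn0 !add1n; move: na a_lb; clear; set w := 3 * _ + _.
  by rewrite !mulnS; lia.
have X'n : #|~: X'| < n.
  apply: leq_trans leX; apply: proper_card; rewrite properC properE XX' /=.
  by apply/subsetPn; exists i.
have [g [i' [ag fg' i'X' [i'0 i'T i'a]]]] := IH X' f X'n af cX' sX'.
have fg := agree_sub XX' fg'.
have i'X : i' \notin X by apply: contra i'X' => /(subsetP XX').
have [i'TX|i'TX] := boolP (i' \in targets (breach g X)); first by exists g, i'.
have [h [x [ah gh hb [xX' gx hx] hY]]] := exchange ag i'X' i'0 i'T i'a.
have [xX agh] := hY X i'X i'TX.
have fh := agree_trans fg agh.
have gi0 : cnt true g i = 0 by rewrite -(agree_cnt _ fg').
have xi : x != i by apply/eqP=> xi; move: gx; rewrite xi gi0.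
have hi0 : cnt true h i = 0.
  by apply/eqP; rewrite -leqn0 -gi0 hb //; apply: contraNneq i'X' => <-.
have fhX' j : ~~ big j -> located f X' j -> f j = h j.
  by move=> nb l; rewrite gh //; case: fg' => _ -> //; rewrite l.
have Psmall j : j \in P -> ~~ big j by move=> /(reach_kind small_i) ->.
have iP j : j \in jobs_at false f i -> located f X' j.
  by rewrite inE => /andP[_ /eqP fj]; rewrite /located fj.
have xT : x \in targets (reach h (jobs_at false h i)).
  have : x \in targets P by move: xX'; rewrite !inE (negPf xX) (negPf xi).
  case/targetsP=> j jP xj; apply/targetsP; exists j => //; apply: (subsetP _ _ jP).
  apply: sub_reach_ext => [|j' j'P].
    apply/subsetP=> j' j'i; have := iP j' j'i; move: j'i; rewrite !inE => /andP[bj' fj'] l.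
    by rewrite bj' -fhX' // (eqP bj').
  apply: fhX'; first exact: Psmall.
  by have [/iP|] := reach_located TX' j'P.
have ux : cnt false h x + k * cnt true h x < a + k.
  rewrite hx (small_cnt _ gh) muln0 addn0.
  have [_ _ _ /(_ x)] := ag; rewrite gx muln1; move: k0; clear; lia.
have [h' [ah' hh' h'i0 h'i]] := augment ah (agree_closed fh cX) iX xX xi xT ux.
apply: (next h') => //; first exact: agree_trans fh hh'.
  by rewrite h'i0.
rewrite (small_cnt _ gh) in h'i.
by rewrite (agree_cnt _ fg').
Qed.

Lemma insert_free f s m :
  admissible f -> f s = None -> m \in targets (reach f [set s]) ->
  cnt false f m + k * cnt true f m < a + k ->
  exists g, [/\ admissible g, g s != None & forall j, g j = None -> f j = None].
Proof.
move=> [vf bf bf1 capf] fs mT um.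
have ns : ~~ big s by apply/negP=> /bf; rewrite fs.
have small_s : {in [set s], forall j, big j = false} by move=> j; rewrite inE => /eqP->; apply: negPf.
have [g [j0 [D [[j0s j0D DR vg] goff _ gon [_ gcnt]]]]] := shift vf small_s mT.
have gD j : j \in D -> g j != None by move=> /gon[->|[j' _ [y _ ->]]].
have gbig j : big j -> g j = f j.
  by move=> bj; apply: goff; apply: contraL bj => /(subsetP DR) /(reach_kind small_s) ->.
have gt y : cnt true g y = cnt true f y by have := gcnt true y; rewrite !mul0n !addn0.
have gf y : cnt false g y = cnt false f y + (m == y).
  by have := gcnt false y; move: j0s; rewrite inE => /eqP->; rewrite fs !mul1n addn0.
exists g; split.
- split=> // [j bj|y|y]; rewrite ?gbig ?gt ?bf // gf.
  by have := capf y; case: (m =P y) um => [<-|_] um; rewrite ?addn0 ?addn1.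
- by apply: gD; move: j0s; rewrite inE => /eqP <-.
- by move=> j; case: (boolP (j \in D)) => [/gD/eqP ng /ng|/goff->].
Qed.

Lemma insert f s :
  admissible f -> f s = None -> Gamma s != set0 ->
  exists g, [/\ admissible g, g s != None & forall j, g j = None -> f j = None].
Proof.
move=> af fs /set0Pn[m0 m0s]; have [vf bf bf1 capf] := af.
have ns : ~~ big s by apply/negP=> /bf; rewrite fs.
have k0 : 0 < k.
  rewrite lt0n; apply/eqP=> k0.
  have : \sum_j (j == s) <= \sum_(i : M) 0.
    apply: (@dual (fun j => j == s) (fun=> 0)) => [i j bj _|i C _].
      by rewrite leqn0 eqb0; apply: contraNneq ns => <-.
    by rewrite k0 leqn0 cards_eq0 => /eqP->; rewrite big_set0.
  by rewrite (bigD1 s) //= eqxx big1_eq.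
pose P := reach f [set s]; pose X := targets P.
have [/existsP[m /andP[mX um]]|/existsPn full] :=
  boolP [exists m, (m \in X) && (cnt false f m + k * cnt true f m < a + k)].
  exact: insert_free mX um.
have cX : closed f X.
  move=> j nb /locatedP[m fj mX]; apply: bigcup_sup.
  by apply: mem_targets_step mX fj _ => j'; rewrite inE => /eqP->; rewrite (negPf nb) (negPf ns).
have sX : surplus f X.
  apply: (@leq_ltn_trans (\sum_(m in X) 3 * k)); first by rewrite sum_nat_const mulnC.
  have w m : m \in X -> 3 * k < 3 * cnt false f m + 2 * k * cnt true f m.
    move=> mX; apply: leq_trans (saturated_weight af _).
      by move: a_lb k0; clear; lia.
    by have := full m; rewrite mX /= -leqNgt.
  have m0X : m0 \in X.
    by apply/targetsP; exists s => //; apply: (subsetP (sub_reach _ _)); rewrite inE.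
  rewrite (bigD1 m0) //= [ltnRHS](bigD1 m0) //= -addSn leq_add ?w //.
  by apply: leq_sum => m /andP[/w/ltnW].
have [g [i [ag fg iX [i0 iT ia]]]] := expose k0 af cX sX.
have [h [x [ah gh hb [xX gx hx] _]]] := exchange ag iX i0 iT ia.
have fg_None j : (f j == None) = (g j == None) by case: fg.
have gh_None j : h j = None -> g j = None.
  by case: (boolP (big j)) => [bj|/gh->] //; have [_ /(_ j bj) /eqP] := ah.
have ux : cnt false h x + k * cnt true h x < a + k.
  rewrite hx (small_cnt _ gh) muln0 addn0.
  have [_ _ _ /(_ x)] := ag; rewrite gx muln1; move: k0; clear; lia.
have hs : h s = None by rewrite gh //; apply/eqP; rewrite -fg_None fs.
have xT : x \in targets (reach h [set s]).
  case/targetsP: xX => j jP xj; apply/targetsP; exists j => //.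
  apply: (subsetP _ _ jP); apply: sub_reach_ext => // j' j'P.
  have [] := reach_located (subxx _) j'P; first by rewrite inE => /eqP->; rewrite fs hs.
  have nb' : ~~ big j'.
    by rewrite (reach_kind _ j'P (b := false)) // => j1; rewrite inE => /eqP->; apply: negPf.
  by move=> l; rewrite gh //; case: fg => _ -> //; rewrite l.
have [h' [ah' h's hh']] := insert_free ah hs xT ux.
exists h'; split=> // j /hh' /gh_None gj; apply/eqP.
by rewrite fg_None gj.
Qed.

Lemma insert_all f :
  (forall j, Gamma j != set0) -> admissible f ->
  exists2 g, admissible g & forall j, g j != None.
Proof.
move=> G0; have [n] := ubnP #|[set j | f j == None]|; elim: n f => // n IH f /ltnSE fn af.
have [/existsP[s /eqP fs]|/existsPn] := boolP [exists s, f s == None]; last by exists f.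
have [g [ag gs gf]] := insert af fs (G0 s); apply: (IH g) => //.
apply: leq_trans fn; apply: proper_card; apply/properP; split.
  by apply/subsetP=> j; rewrite !inE => /eqP/gf->.
by exists s; rewrite inE ?fs.
Qed.

End PartialSchedules.

Section Matching.
Variables (J M : finType) (Gamma : J -> {set M}) (big : pred J).

Lemma big_matching :
  (forall A : {set J}, {in A, forall j, big j} -> #|A| <= #|targets Gamma A|) ->
  exists f : J -> option M, [/\ valid Gamma f, forall j, (f j != None) = big j
    & forall m, cnt big true f m <= 1].
Proof.
move=> hall.
suff step_one n (f : J -> option M) : #|[set j | big j && (f j == None)]| <= n ->
    valid Gamma f -> (forall j, ~~ big j -> f j = None) -> (forall m, cnt big true f m <= 1) ->
    exists g : J -> option M, [/\ valid Gamma g, forall j, (g j != None) = big j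
      & forall m, cnt big true g m <= 1].
  apply: (step_one _ (fun=> None) (leqnn _)) => // m.
  by rewrite /cnt /jobs_at; set A := [set _ | _]; have -> : A = set0;
    [apply/setP=> j; rewrite !inE andbF | rewrite cards0].
elim: n f => [|n IH] f fn vf sf f1.
  exists f; split=> // j; move: fn; rewrite leqn0 cards_eq0 => /eqP/setP/(_ j).
  by rewrite !inE; case: (boolP (big j)) => [_ /= ->|/sf ->].
have [/existsP[s /andP[bs /eqP fs]]|/existsPn all_big] :=
    boolP [exists s, big s && (f s == None)]; last first.
  exists f; split=> // j; have := all_big j.
  by case: (boolP (big j)) => [_ /= ->|/sf ->].
pose P := reach Gamma big f [set s].
have big_s : {in [set s], forall j, big j = true} by move=> j; rewrite inE => /eqP->.
have bigP : {in P, forall j, big j} by move=> j /(reach_kind big_s).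
have [/existsP[m /andP[mT /eqP m0]]|/existsPn full] :=
  boolP [exists m, (m \in targets Gamma P) && (cnt big true f m == 0)]; last first.
  have := hall P bigP; rewrite leqNgt => /negP[].
  have sP : s \in P by apply: (subsetP (sub_reach _ _ _ _)); rewrite inE.
  rewrite (cardsD1 s P) sP ltnS -(card_imset _ Some_inj).
  apply: leq_trans (leq_imset_card f _); apply: subset_leq_card.
  apply/subsetP=> _ /imsetP[m mT ->]; have := full m; rewrite mT /= => /cntP[j bj fj].
  rewrite -fj imset_f // in_setD1; apply/andP; split.
    by apply/eqP=> js; move: fj; rewrite js fs.
  by apply: mem_targets_step mT fj _ => j' /big_s ->.
have [g [j0 [D [[j0s j0D DR vg] goff _ gon [_ gcnt]]]]] := shift vf big_s mT.
have {}j0s : j0 = s by move: j0s; rewrite inE => /eqP.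
have gD j : j \in D -> g j != None by move=> /gon[->|[j' _ [y _ ->]]].
have nD j : ~~ big j -> j \notin D by apply: contra => /(subsetP DR) /bigP.
apply: (IH g) => // [|j nb|m'].
- rewrite -ltnS; apply: leq_trans fn; apply: proper_card; apply/properP; split.
    apply/subsetP=> j; rewrite !inE => /andP[-> gj] /=.
    by case: (boolP (j \in D)) gj => [/gD/negPf->|/goff->].
  by exists s; rewrite !inE bs ?fs //= -j0s gD.
- by rewrite goff ?nD ?sf.
have := gcnt true m'; rewrite j0s fs !mul1n addn0 => ->.
by case: (m =P m') => [<-|_]; rewrite ?m0 ?addn0.
Qed.

End Matching.

Local Open Scope ring_scope.

Section Rounding.
Variables (R : realFieldType) (J M : finType) (p : J -> R) (Gamma : J -> {set M}).

Lemma config_LP_dual (T : R) (z : J -> nat) (y : M -> nat) :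
  config_LP_feasible p Gamma T ->
  (forall i C, is_config p Gamma T i C -> \sum_(j in C) z j <= y i)%N ->
  (\sum_j z j <= \sum_i y i)%N.
Proof.
case=> x [x0 x1 x2] zy; rewrite -(ler_nat R) !natr_sum.
apply: (@le_trans _ _ (\sum_i \sum_(C | is_config p Gamma T i C) (y i)%:R * x i C)); last first.
  by apply: ler_sum => i _; rewrite -mulr_sumr ler_piMr ?ler0n.
apply: (@le_trans _ _ (\sum_i \sum_(C | is_config p Gamma T i C) (\sum_(j in C) z j)%:R * x i C)).
  under [leRHS]eq_bigr do under eq_bigr do rewrite natr_sum mulr_suml.
  under [leRHS]eq_bigr do rewrite (exchange_big_dep xpredT) //=.
  rewrite [leRHS]exchange_big /=; apply: ler_sum => j _.
  under eq_bigr do rewrite -mulr_sumr.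
  by rewrite -mulr_sumr ler_peMr ?ler0n.
by do 2!(apply: ler_sum => ? ?); rewrite ler_wpM2r ?x0 // ler_nat zy.
Qed.

Lemma extend_schedule (f : J -> option M) :
  (forall j, Gamma j != set0) -> valid Gamma f ->
  exists sigma, is_schedule Gamma sigma /\ forall j m, f j = Some m -> sigma j = m.
Proof.
move=> G0 vf; have G0' j : exists m, m \in Gamma j by apply/set0Pn.
exists (fun j => if f j is Some m then m else xchoose (G0' j)); split=> [j|j m -> //].
by case fj: (f j) => [m|]; [apply: vf | apply: xchooseP].
Qed.

Variable eps : R.
Hypotheses (eps_ge0 : 0 <= eps) (two_sizes : forall j, p j = eps \/ p j = 1).
Let big j := p j == 1.

Lemma p_ge0 j : 0 <= p j.
Proof. by case: (two_sizes j) => ->. Qed.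

Lemma p_small j : ~~ big j -> p j = eps.
Proof. by rewrite /big; case: (two_sizes j) => -> //; rewrite eqxx. Qed.

Lemma config_pair i C j j' : is_config p Gamma 1 i C ->
  j \in C -> big j -> j' \in C -> j' != j -> p j' = 0.
Proof.
move=> /andP[_ C1] jC /eqP pj j'C j'j; apply/eqP; rewrite eq_le p_ge0 andbT.
move: C1; rewrite (big_setD1 j) //= pj gerDl; apply: le_trans.
rewrite (big_setD1 j') /= ?in_setD1 ?j'j // lerDl.
by apply: sumr_ge0 => ? _; apply: p_ge0.
Qed.

Lemma config_target i C j : is_config p Gamma 1 i C -> j \in C -> i \in Gamma j.
Proof. by move=> /andP[/subsetP CG _] /CG; rewrite inE. Qed.

Lemma hall_big (A : {set J}) :
  config_LP_feasible p Gamma 1 -> {in A, forall j, big j} -> (#|A| <= #|targets Gamma A|)%N.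
Proof.
move=> lp Ab; have := @config_LP_dual 1 (fun j => j \in A) (fun i => i \in targets Gamma A) lp.
rewrite -!big_mkcond /= !sum1_card; apply=> i C Cc.
have [/existsP[j /andP[jC jA]]|/existsPn CA] := boolP [exists j, (j \in C) && (j \in A)].
  have -> : i \in targets Gamma A by apply/targetsP; exists j => //; apply: config_target Cc jC.
  rewrite (big_setD1 j) //= jA big1 // => j'; rewrite in_setD1 => /andP[j'j j'C].
  apply/eqP; rewrite eqb0; apply/negP=> /Ab /eqP; rewrite (config_pair Cc jC (Ab j jA) j'C j'j).
  by apply/eqP; rewrite eq_sym oner_eq0.
by rewrite big1 // => j jC; have := CA j; rewrite jC /= => /negPf->.
Qed.

Lemma load_cnt (f : J -> option M) sigma i :
  (forall j m, f j = Some m -> sigma j = m) -> (forall j, f j != None) ->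
  load p sigma i = (cnt big true f i)%:R + (cnt big false f i)%:R * eps.
Proof.
move=> fs fN.
have sf j : (sigma j == i) = (f j == Some i).
  by case fj: (f j) (fN j) => [m|] // _; rewrite (fs _ _ fj) (inj_eq Some_inj).
rewrite /load (bigID big) /=; congr (_ + _).
  rewrite (eq_bigr (fun=> 1)) => [|j /andP[_ /eqP] //].
  rewrite sumr_const; congr (_ *+ _); apply: eq_card => j.
  by rewrite !inE eqb_id andbC -sf.
rewrite (eq_bigr (fun=> eps)) => [|j /andP[_ /p_small] //].
rewrite sumr_const mulr_natl; congr (_ *+ _); apply: eq_card => j.
by rewrite !inE eqbF_neg andbC -sf.
Qed.

End Rounding.

Theorem theorem2 (R : realFieldType) (J M : finType)
    (p : J -> R) (Gamma : J -> {set M}) (eps : R) :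
  0 <= eps ->
  (forall j, Gamma j != set0) ->
  (forall j, p j = eps \/ p j = 1) ->
  is_OPT_LP p Gamma 1 ->
  exists sigma : J -> M,
    is_schedule Gamma sigma /\ makespan_le p sigma (5 / 3 + eps).
Proof.
move=> eps0 G0 sizes [lp _]; pose big j := p j == 1.
have [f [vf fbig f1]] := big_matching (fun A => @hall_big _ _ _ _ _ _ eps0 sizes A lp).
have [eps_eq0|eps_neq0] := eqVneq eps 0.
  have [sigma [sched sf]] := extend_schedule G0 vf.
  exists sigma; split=> // i; apply: (@le_trans _ _ 1); last by lra.
  have -> : load p sigma i = (cnt big true f i)%:R; last by rewrite (ler_nat _ _ 1) f1.
  rewrite /load (bigID big) /= [X in _ + X]big1 ?addr0 => [|j /andP[_ /(p_small sizes)] -> //].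
  rewrite (eq_bigr (fun=> 1)) => [|j /andP[_ /eqP] //].
  rewrite sumr_const; congr (_ *+ _); apply: eq_card => j.
  rewrite [LHS]unfold_in inE eqb_id; case bj: (big j); rewrite ?andbF //= andbT.
  have := fbig j; rewrite -/(big j) bj.
  by case fj: (f j) => [m|] // _; rewrite (sf _ _ fj) (inj_eq Some_inj).
have eps_gt0 : 0 < eps by rewrite lt_def eps_neq0.
(* [R] need not be archimedean, so [floor (1 / eps)] is truncated at the number of jobs. *)
pose k := (\max_(c < #|J|.+1 | (c%:R * eps <= 1)%R) c)%N; pose a := (2 * k %/ 3).+1.
have k_eps : k%:R * eps <= 1.
  rewrite /k; elim/big_ind: _ => // [|m n hm hn]; first by rewrite mul0r ler01.
  by case: (leqP m n).
have le_k c : (c <= #|J|)%N -> c%:R * eps <= 1 -> (c <= k)%N.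
  by move=> cJ ce; rewrite -[c]/(val (Ordinal (cJ : c < #|J|.+1)%N)) leq_bigmax_cond.
have a_lb : (2 * k < 3 * a)%N by rewrite /a; clear; lia.
have a_ub : (3 * a <= 2 * k + 3)%N by rewrite /a; clear; lia.
have dual (z : J -> nat) (y : M -> nat) :
    (forall i j, big j -> i \in Gamma j -> z j <= y i)%N ->
    (forall i (C : {set J}), (forall j, j \in C -> ~~ big j && (i \in Gamma j)) ->
       #|C| <= k -> \sum_(j in C) z j <= y i)%N ->
    (\sum_j z j <= \sum_i y i)%N.
  move=> zbig zsmall; apply: config_LP_dual lp _ => i C Cc.
  have [/existsP[j /andP[jC bj]]|/existsPn Cs] := boolP [exists j, (j \in C) && big j].
    rewrite (big_setD1 j) //= big1 ?addn0 => [|j'].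
      by apply: zbig => //; apply: config_target Cc jC.
    rewrite in_setD1 => /andP[j'j j'C].
    have /eqP := config_pair eps0 sizes Cc jC bj j'C j'j.
    by case: (sizes j') => ->; rewrite ?oner_eq0 ?(negPf eps_neq0).
  have Csmall j : j \in C -> ~~ big j by move=> jC; have := Cs j; rewrite jC.
  apply: zsmall => [j jC|]; first by rewrite Csmall //= (config_target Cc jC).
  apply: le_k; first exact: max_card.
  case/andP: Cc => _; rewrite (eq_bigr (fun=> eps)); first by rewrite sumr_const mulr_natl.
  by move=> j /Csmall; apply: p_small.
have af : admissible Gamma big k a f.
  have fs m : cnt big false f m = 0.
    apply/eqP; rewrite cards_eq0 -subset0; apply/subsetP=> j; rewrite !inE => /andP[/eqP bj /eqP fj].
    by have := fbig j; rewrite -/(big j) bj fj.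
  split=> // [j bj|m]; first by rewrite fbig.
  by rewrite fs add0n; have := f1 m; rewrite -/big; case: (cnt _ _ _ _) => [|[|//]];
    rewrite ?muln0 ?muln1 // leq_addl.
have [g [vg _ g1 capg] gN] := insert_all dual a_lb G0 af.
have [sigma [sched sg]] := extend_schedule G0 vg.
exists sigma; split=> // i; rewrite (load_cnt sizes i sg gN) -/big.
have a_eps : 3 * (a%:R * eps) <= 2 + 3 * eps.
  have : (3 * a)%:R * eps <= (2 * k + 3)%:R * eps by rewrite ler_pM2r ?ler_nat.
  rewrite natrD !natrM; lra.
have := capg i; rewrite -(ler_nat R) -(ler_pM2r eps_gt0).
have : (cnt big true g i == 0) || (cnt big true g i == 1) by have := g1 i; case: (cnt _ _ _ _) => [|[|]].
case/orP=> /eqP ->; rewrite ?muln0 ?muln1 !natrD !mulrDl; lra.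
Qed.
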